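(* Let $N\ge 1$ and let $\zeta=(\zeta_1,\dots,\zeta_N)\in\{0,1\}^N$ be a random vector whose entries are independent Bernoulli variables with success probabilities $p=(p_1,\dots,p_N)\in[0,1]^N$. Let $Z=\sum_{i=1}^N\zeta_i$, and let $$S=\{1,\dots,N\},\quad O=\{i\in S: p_i=0\},\quad I=\{i\in S: p_i=1\},\quad V=S\setminus(I\cup O).$$ Then the probability mass function of $Z$ (the Poisson binomial model over the closed domain $[0,1]^N$) is $$\mathbb P(Z=z)=R(z-|I|,V)\prod_{j\in V}(1-p_j)=\frac{R(z-|I|,V)}{\prod_{j\in V}(1+w_j)}.$$
   Context: For $j$ with $p_j\in[0,1)$ put $w_j=\frac{p_j}{1-p_j}$. For an integer $k$ and $A\subseteq S$ on which the weights are defined, $R(k,A)=\sum_{B\subseteq A,\ |B|=k}\prod_{i\in B}w_i$, with $R(0,A)=1$ and $R(k,A)=0$ if $k<0$ or $k>|A|$. Empty products equal $1$. *)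

(* Defs.v *)
From HB Require Import structures.
From mathcomp Require Import all_boot all_order all_algebra.
From mathcomp Require Import all_classical all_reals all_analysis.

Set Implicit Arguments.
Unset Strict Implicit.
Unset Printing Implicit Defensive.

Import Order.TTheory GRing.Theory Num.Theory.
Import numFieldNormedType.Exports.

Local Open Scope classical_set_scope.
Local Open Scope ring_scope.

(* Mutual independence of a finite family of random variables: the product
   rule over every subfamily and all measurable events. *)
Definition mutually_independent (R : realType) (d d' : measure_display)
    (T : measurableType d) (T' : measurableType d') (P : probability T R)
    (I : finType) (X : I -> {RV P >-> T'}) : Prop :=
  forall (J : {set I}) (A : I -> set T'),
    (forall i, i \in J -> measurable (A i)) ->
    P (\bigcap_(i in [set` J]) (X i @^-1` A i)) =
    (\prod_(i in J) P (X i @^-1` A i))%E.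

(* The number of successes, as a real-valued random variable; [b%:R] is 1 if
   [b] is [true] and 0 otherwise. *)
Definition successes (R : realType) (d : measure_display)
    (T : measurableType d) (P : probability T R) (N : nat)
    (zeta : 'I_N -> {RV P >-> bool}) : T -> R :=
  fun t => \sum_(i < N) (zeta i t)%:R.

Lemma measurable_successes (R : realType) (d : measure_display)
    (T : measurableType d) (P : probability T R) (N : nat)
    (zeta : 'I_N -> {RV P >-> bool}) :
  measurable_fun setT (successes zeta).
Proof.
apply: measurable_sum => i.
by apply: (@measurableT_comp _ _ _ _ _ _ (fun b : bool => b%:R : R)).
Qed.

HB.instance Definition _ (R : realType) (d : measure_display)
    (T : measurableType d) (P : probability T R) (N : nat)
    (zeta : 'I_N -> {RV P >-> bool}) :=
  isMeasurableFun.Build _ _ _ _ (successes zeta) (measurable_successes zeta).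

Section parameters.
Context (R : realType) (N : nat) (p : 'I_N -> R).

(* [odds j] is only meaningful when [p j != 1]; division by 0 yields 0. *)
Definition odds (j : 'I_N) : R := p j / (1 - p j).

Definition never : {set 'I_N} := [set i | p i == 0]%SET.
Definition always : {set 'I_N} := [set i | p i == 1]%SET.
Definition varying : {set 'I_N} := (~: (always :|: never))%SET.

(* $R(k, A)$: the [k]-th elementary symmetric function of the weights indexed
   by [A], for an arbitrary integer [k]. *)
Definition Rfun (k : int) (A : {set 'I_N}) : R :=
  \sum_(B : {set 'I_N} | (B \subset A) && (#|B|%:Z == k))
    \prod_(i in B) odds i.

Lemma Rfun0 (A : {set 'I_N}) : Rfun 0 A = 1.
Proof.
rewrite /Rfun (big_pred1 finset.set0) ?big_set0// => B /=.
rewrite eqz_nat cards_eq0 andb_idl// => /eqP ->.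
exact: finset.sub0set.
Qed.

Lemma Rfun_lt0 (k : int) (A : {set 'I_N}) : k < 0 -> Rfun k A = 0.
Proof.
by move=> k0; rewrite /Rfun big1// => B /andP[_ /eqP Bk]; rewrite -Bk in k0.
Qed.

Lemma Rfun_gt (k : int) (A : {set 'I_N}) : #|A|%:Z < k -> Rfun k A = 0.
Proof.
move=> Ak; rewrite /Rfun big1// => B /andP[/subset_leq_card BA /eqP Bk].
by move: Ak; rewrite -Bk ltz_nat ltnNge BA.
Qed.

End parameters.

(* Main.v *)
(** Z is constant on each cell {zeta = 1_B}, whose probability is the product
    over all i of p_i or 1 - p_i according to whether i is in B.  Only the sets
    B = I union C with C a subset of V have a nonzero product, and factoring out
    the 1 - p_j for j in V leaves the product of the weights over C. *)
Require Import Defs.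
From mathcomp Require Import all_boot all_order all_algebra.
From mathcomp Require Import all_classical all_reals all_analysis.

Set Implicit Arguments.
Unset Strict Implicit.
Unset Printing Implicit Defensive.

Import Order.TTheory GRing.Theory Num.Theory.
Import numFieldNormedType.Exports.

Local Open Scope classical_set_scope.
Local Open Scope ring_scope.

Section poisson_binomial.
Context (R : realType) (N : nat) (p : 'I_N -> R).

Definition outcome_weight (B : {set 'I_N}) : R :=
  \prod_i (if i \in B then p i else 1 - p i).

(** The identity holds factor by factor: an index in [always p] or [never p] gives 1 on both sides,
    and an index of [C] gives [p i], which is [1 - p i] times its odds. *)
Lemma outcome_weight_always_varying (C : {set 'I_N}) :
  C \subset varying p ->
  outcome_weight (always p :|: C)%SET =
    (\prod_(j in varying p) (1 - p j)) * \prod_(i in C) odds p i.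
Proof.
move=> /fintype.subsetP CV; rewrite /outcome_weight.
rewrite (big_mkcond (fun j => j \in varying p)) (big_mkcond (fun i => i \in C)).
rewrite -big_split/=; apply: eq_bigr => i _.
have := CV i; rewrite !inE /odds.
have [->|pi1] := eqVneq (p i) 1.
  (* Here [odds p i] would be the default value 0 of a division by zero; [C \subset varying p]
     excludes [i \in C]. *)
  by case: (i \in C) => [/(_ isT)|_] //; rewrite mulr1.
have [->|pi0] := eqVneq (p i) 0.
  case: (i \in C) => [/(_ isT)|_];
    by rewrite ?orbT//= ?orbF ?eqxx ?subr0 ?mulr1.
move=> _ /=; case: ifP => _; last by rewrite mulr1.
by rewrite mulrCA divff ?mulr1// subr_eq0 eq_sym.
Qed.

(** A certain success missing from [B], or an impossible one lying in [B], would make a factor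
    vanish. *)
Lemma outcome_weight_neq0 (B : {set 'I_N}) : outcome_weight B != 0 ->
  (always p :|: (B :&: varying p))%SET = B.
Proof.
move=> /prodf_neq0 B0; apply/setP => i; rewrite !inE.
have := B0 i isT.
have [->|pi1] := eqVneq (p i) 1; first by case: ifP => //; rewrite subrr eqxx.
have [->|pi0] := eqVneq (p i) 0; first by case: ifP => //; rewrite eqxx.
by rewrite /= andbT.
Qed.

Lemma sum_outcome_weight (z : int) :
  \sum_(B : {set 'I_N} | #|B|%:Z == z) outcome_weight B =
    Rfun p (z - #|always p|%:Z) (varying p) * \prod_(j in varying p) (1 - p j).
Proof.
have aIV (C : {set 'I_N}) : C \subset varying p ->
    ((always p :|: C) :&: varying p)%SET = C.
  move=> /fintype.subsetP CV; apply/setP => i; have := CV i; rewrite !inE.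
  by case: (i \in C) => [->|]//; rewrite ?orbT// orbF; case: (p i == 1).
(* Split off the sets not determined by their varying part; their weights are all zero. *)
rewrite (bigID (fun B : {set 'I_N} =>
  (always p :|: (B :&: varying p))%SET == B))/= addrC big1 ?add0r; last first.
  by move=> B /andP[_]; apply: contraNeq => /outcome_weight_neq0 /eqP.
(* On the remaining sets, [B] and its varying part [C] determine each other. *)
rewrite (reindex_onto (fun C => always p :|: C)%SET
  (fun B => B :&: varying p)%SET)/=; last by move=> B /andP[_ /eqP].
rewrite /Rfun mulr_suml.
have disj (C : {set 'I_N}) : C \subset varying p ->
    #|(always p :|: C)%SET|%:Z = #|always p|%:Z + #|C|%:Z.
  move=> CV; rewrite cardsU disjoint_setI0 ?cards0 ?subn0 ?PoszD//.
  rewrite disjoint_subset; apply/fintype.subsetP => i; rewrite !inE => /eqP pi1.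
  apply/negP => /(fintype.subsetP CV); by rewrite !inE pi1 eqxx.
apply: eq_big => [C|C /andP[_ /eqP VC]]; last first.
  have CV : C \subset varying p by rewrite -VC; exact: subsetIr.
  by rewrite (outcome_weight_always_varying CV); exact: mulrC.
have [CV|CV] := boolP (C \subset varying p).
  rewrite !aIV// !eqxx !andbT disj//=.
  (* Adding [#|always p|] to both sides turns the size condition on [C] into the one on the
     union. *)
  by rewrite -[RHS](inj_eq (addrI #|always p|%:Z)) addrC subrKC addrC.
(* If [C] is not inside [varying p], intersecting the union with [varying p] cannot give back
   [C]. *)
apply/negbTE; rewrite !negb_and; apply/orP; right.
by apply: contra CV => /eqP <-; exact: subsetIr.
Qed.

(** Since [p j != 1] on [varying p], each [1 + odds p j] is the inverse of [1 - p j]. *)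
Lemma prod_one_sub_odds :
  \prod_(j in varying p) (1 - p j) = (\prod_(j in varying p) (1 + odds p j))^-1.
Proof.
rewrite -prodfV; apply: eq_bigr => j; rewrite !inE negb_or => /andP[pj1 _].
have nz : 1 - p j != 0 by rewrite subr_eq0 eq_sym.
by rewrite /odds -[X in X + p j / _](divff nz) -mulrDl subrK mul1r invrK.
Qed.

Context (d : measure_display) (T : measurableType d) (P : probability T R)
  (zeta : 'I_N -> {RV P >-> bool}).

(** The event that the successes are exactly [B], written as an intersection over the full index set
    so that [mutually_independent] applies directly. *)
Definition outcome (B : {set 'I_N}) : set T :=
  \bigcap_(i in [set` [set: 'I_N]%SET]) (zeta i @^-1` [set i \in B]).

Lemma outcomeP (B : {set 'I_N}) t :
  outcome B t <-> [set i | zeta i t]%SET = B.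
Proof.
split=> [Bt|<- i _ /=]; last by rewrite inE.
by apply/setP => i; rewrite inE; apply: Bt; rewrite /= inE.
Qed.

Lemma measurable_outcome (B : {set 'I_N}) : measurable (outcome B).
Proof.
apply: fin_bigcap_measurable => [|i _]; first exact: finite_finset.
exact: measurable_funPTI.
Qed.

Lemma preimage_successes (z : int) :
  (successes zeta : T -> R) @^-1` [set z%:~R] =
    \bigcup_(B in [set B : {set 'I_N} | #|B|%:Z == z]) outcome B.
Proof.
(* The cast goes through the integers so that comparison with [z] reduces to injectivity of their
   embedding in [R]. *)
have succE t : successes zeta t = #|[set i | zeta i t]%SET|%:Z%:~R :> R.
  rewrite /successes -natr_sum -pmulrn.
  congr (_%:R); rewrite -sum1_card [RHS]big_mkcond/=.
  by apply: eq_bigr => i _; rewrite inE; case: (zeta i t).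
apply/seteqP; split=> t /=.
  rewrite succE => /intr_inj tz.
  by exists [set i | zeta i t]%SET; [exact/eqP|exact/outcomeP].
by move=> [B /= /eqP <- /outcomeP <-].
Qed.

Hypothesis p01 : forall i, 0 <= p i <= 1.
Hypothesis zeta_bernoulli : forall i,
  distribution P (zeta i) = bernoulli_prob (p i) :> (set bool -> \bar R).
Hypothesis zeta_indep : mutually_independent zeta.

Lemma probability_outcome (B : {set 'I_N}) :
  P (outcome B) = (outcome_weight B)%:E.
Proof.
rewrite /outcome zeta_indep// /outcome_weight -prodEFin.
apply: eq_big => [i|i _]; first by rewrite inE.
transitivity (bernoulli_prob (p i) [set i \in B]).
  by rewrite -zeta_bernoulli.
(* The Bernoulli law is a mixture of two Dirac masses, of which the singleton of [i \in B] selects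
   one. *)
rewrite bernoulli_probE// !diracE.
by case: (i \in B); rewrite !in_set1/= ?mule1 ?mule0 ?adde0 ?add0e.
Qed.

Lemma pmf_successes (z : int) :
  pmf (successes zeta : {RV P >-> R}) z%:~R =
    \sum_(B : {set 'I_N} | #|B|%:Z == z) outcome_weight B.
Proof.
rewrite /pmf preimage_successes measure_fin_bigcup//; last 3 first.
- exact: finite_finset.
(* The cells are disjoint because a sample point determines its set of successes. *)
- by move=> B C _ _ [t [/outcomeP <- /outcomeP <-]].
- by move=> B _; exact: measurable_outcome.
rewrite -(bigfs _ (index_enum_uniq _)); last first.
  by move=> B _; rewrite mem_index_enum.
by rewrite (eq_bigr _ (fun B _ => probability_outcome B)) sumEFin.
Qed.

End poisson_binomial.

Theorem theorem3p1 (R : realType) (d : measure_display) (T : measurableType d)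
    (P : probability T R) (N : nat) (p : 'I_N -> R)
    (zeta : 'I_N -> {RV P >-> bool})
    (N_ge1 : (1 <= N)%N)
    (p01 : forall i, 0 <= p i <= 1)
    (zeta_bernoulli : forall i,
      distribution P (zeta i) = bernoulli_prob (p i) :> (set bool -> \bar R))
    (zeta_indep : mutually_independent zeta)
    (z : int) :
  pmf (successes zeta : {RV P >-> R}) z%:~R =
    Rfun p (z - #|always p|%:Z) (varying p)
      * \prod_(j in varying p) (1 - p j) /\
  Rfun p (z - #|always p|%:Z) (varying p)
      * \prod_(j in varying p) (1 - p j) =
    Rfun p (z - #|always p|%:Z) (varying p)
      / \prod_(j in varying p) (1 + odds p j).
Proof.
split; last by rewrite prod_one_sub_odds.
by rewrite (pmf_successes p01)// sum_outcome_weight.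
Qed.
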